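(* Let $G=(V,E)$ be a finite connected graph with vertices $v_1,\dots,v_n$, $n=|V|$, and distance matrix $D=(d(v_i,v_j))_{i,j=1}^n$. Suppose $G$ is nonnegatively curved, i.e. there is $w\in\mathbb{R}^n_{\ge 0}$ with $Dw=n\cdot\mathbf{1}$, and let $\|w\|_{\ell^1}$ be its total curvature. Then for every probability measure $\nu$ on $V$, $$\min_{a\in V}\sum_{v\in V}d(a,v)\,\nu(v)\ \le\ \frac{n}{\|w\|_{\ell^1}}\ \le\ \max_{b\in V}\sum_{v\in V}d(b,v)\,\nu(v).$$
   Context: Graphs are finite, simple, undirected and unweighted; $d(u,v)$ is the shortest-path (combinatorial) distance, $\mathbf{1}\in\mathbb{R}^n$ is the all-ones vector, and $\|w\|_{\ell^1}=\sum_i|w_i|$. A probability measure on $V$ is a function $\nu:V\to[0,\infty)$ with $\sum_{v\in V}\nu(v)=1$. *)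

(* Defs.v *)
From HB Require Import structures.
From mathcomp Require Import all_boot all_order all_algebra.
From mathcomp Require Import reals.

Set Implicit Arguments.
Unset Strict Implicit.
Unset Printing Implicit Defensive.

Import Order.TTheory GRing.Theory Num.Theory.
Local Open Scope ring_scope.

Definition simple_graph (V : finType) (e : rel V) : Prop :=
  symmetric e /\ irreflexive e.

Definition connected_graph (V : finType) (e : rel V) : Prop :=
  forall x y : V, connect e x y.

Definition walk_of_length (V : finType) (e : rel V) (x y : V) : pred nat :=
  fun k => [exists p : k.-tuple V, path e x p && (last x p == y)].

Lemma connected_walk (V : finType) (e : rel V) (conn : connected_graph e)
  (x y : V) : exists k, walk_of_length e x y k.
Proof.
have /connectP[p px ->] := conn x y.
by exists (size p); apply/existsP; exists (in_tuple p); rewrite px eqxx.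
Qed.

(* Connectedness is an argument, so no default value is needed for pairs of
   vertices not joined by any walk. *)
Definition gdist (V : finType) (e : rel V) (conn : connected_graph e)
  (x y : V) : nat := ex_minn (connected_walk conn x y).

Definition distance_matrix (R : realType) (V : finType) (e : rel V)
  (conn : connected_graph e) (v : 'I_#|V| -> V) : 'M[R]_#|V| :=
  \matrix_(i, j) (gdist conn (v i) (v j))%:R.

Definition l1norm (R : realType) (n : nat) (w : 'cV[R]_n) : R :=
  \sum_(i < n) `|w i ord0|.

Definition prob_measure (R : realType) (V : finType) (nu : V -> R) : Prop :=
  (forall x, 0 <= nu x) /\ \sum_(x : V) nu x = 1.

Definition mean_dist (R : realType) (V : finType) (e : rel V)
  (conn : connected_graph e) (nu : V -> R) (a : V) : R :=
  \sum_(x : V) (gdist conn a x)%:R * nu x.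

(* Minimum and maximum over a finite type that is nonempty, as witnessed by
   [x0]; their values do not depend on [x0]. *)
Definition fmin (R : realType) (V : finType) (x0 : V) (F : V -> R) : R :=
  \big[Num.min/F x0]_(x : V) F x.

Definition fmax (R : realType) (V : finType) (x0 : V) (F : V -> R) : R :=
  \big[Num.max/F x0]_(x : V) F x.

(* Main.v *)
Require Import Defs.
From HB Require Import structures.
From mathcomp Require Import all_boot all_order all_algebra.
From mathcomp Require Import reals.

(** Average the function [mean_dist conn nu] over the vertices with the curvature
    [w] as weights.  Exchanging the two finite sums and using the symmetry of
    the distance, the vertex [x] contributes [nu x] times the entry of [D w]
    at [x], which is [n]; since [nu] has total mass one, the weighted sum is
    exactly [n], whatever [nu] is ([curvature_mean_dist]).  As [w] is
    nonnegative, its total weight is [l1norm w], which is positive because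
    [D w = n 1] is nonzero ([l1norm_gt0]).  Hence [n / l1norm w] is a weighted
    average of the values of [mean_dist conn nu], and it lies between their
    minimum and their maximum. *)

Set Implicit Arguments.
Unset Strict Implicit.
Unset Printing Implicit Defensive.

Import Order.TTheory GRing.Theory Num.Theory.
Local Open Scope ring_scope.

Lemma walk_of_length_rev (V : finType) (e : rel V) (x y : V) (k : nat) :
  symmetric e -> walk_of_length e x y k -> walk_of_length e y x k.
Proof.
move=> e_sym /existsP[p /andP[px /eqP <-]].
have size_rev : size (rev (belast x p)) == k.
  by rewrite size_rev size_belast size_tuple.
apply/existsP; exists (Tuple size_rev) => /=.
rewrite rev_path (eq_path (e' := e)) ?px /=; last by move=> a b; rewrite e_sym.
by case: (tval p) => [|a s] //=; rewrite rev_cons last_rcons.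
Qed.

Lemma gdistC (V : finType) (e : rel V) (conn : connected_graph e) (x y : V) :
  symmetric e -> gdist conn x y = gdist conn y x.
Proof.
move=> e_sym; apply: eq_ex_minn => k.
by apply/idP/idP; apply: walk_of_length_rev.
Qed.

Lemma fmin_le (R : realType) (V : finType) (x0 : V) (F : V -> R) (x : V) :
  fmin x0 F <= F x.
Proof. by rewrite /fmin; apply: bigmin_le_cond. Qed.

Lemma le_fmax (R : realType) (V : finType) (x0 : V) (F : V -> R) (x : V) :
  F x <= fmax x0 F.
Proof. by rewrite /fmax; apply: le_bigmax_cond. Qed.

Lemma l1norm_nneg (R : realType) (n : nat) (w : 'cV[R]_n) :
  (forall i, 0 <= w i ord0) -> l1norm w = \sum_(i < n) w i ord0.
Proof. by move=> w_ge0; apply: eq_bigr => i _; rewrite ger0_norm. Qed.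

Lemma l1norm_gt0 (R : realType) (n : nat) (w : 'cV[R]_n) :
  w != 0 -> 0 < l1norm w.
Proof.
move=> w_neq0; rewrite lt_def sumr_ge0 // andbT.
apply: contra w_neq0 => /eqP/psumr_eq0P w0.
apply/eqP/colP => i; rewrite mxE; apply/eqP.
by rewrite -normr_eq0 w0.
Qed.

(** Distance is a symmetric kernel, so pairing [w] with the potential of [nu]
    is pairing [nu] with the potential [D w] of [w]; the latter is constant,
    so only the total mass of [nu] matters. *)
Lemma curvature_mean_dist (R : realType) (V : finType) (e : rel V)
  (conn : connected_graph e) (v : 'I_#|V| -> V) (w : 'cV[R]_#|V|) (c : R)
  (nu : V -> R) :
  symmetric e -> bijective v ->
  distance_matrix R conn v *m w = c *: const_mx 1 -> prob_measure nu ->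
  \sum_i w i ord0 * mean_dist conn nu (v i) = c.
Proof.
move=> e_sym [u vK uK] Dw [_ nu1].
under eq_bigr do rewrite mulr_sumr.
rewrite exchange_big -[RHS]mul1r -[X in X * c]nu1 mulr_suml; apply: eq_bigr => x _.
have /colP/(_ (u x)) := Dw; rewrite !mxE mulr1 => <-.
rewrite mulr_sumr; apply: eq_bigr => i _.
by rewrite mxE uK (gdistC _ x) // mulrA mulrC [w i _ * _]mulrC.
Qed.

Theorem theorem4 (R : realType) (V : finType) (e : rel V)
  (graph_e : simple_graph e) (conn : connected_graph e)
  (v : 'I_#|V| -> V) (v_bij : bijective v)
  (w : 'cV[R]_#|V|) (w_ge0 : forall i, 0 <= w i ord0)
  (Dw : distance_matrix R conn v *m w = #|V|%:R *: const_mx 1)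
  (nu : V -> R) (nu_prob : prob_measure nu) (x0 : V) :
  fmin x0 (mean_dist conn nu) <= #|V|%:R / l1norm w /\
  #|V|%:R / l1norm w <= fmax x0 (mean_dist conn nu).
Proof.
have avg := curvature_mean_dist (proj1 graph_e) v_bij Dw nu_prob.
have n_neq0 : #|V|%:R != 0 :> R.
  by rewrite pnatr_eq0 -lt0n; apply/card_gt0P; exists x0.
have w_gt0 : 0 < l1norm w.
  apply: l1norm_gt0; apply: contraNneq n_neq0 => w0.
  by move/colP/(_ (enum_rank x0)): Dw; rewrite w0 mulmx0 !mxE mulr1 => <-.
rewrite ler_pdivlMr // ler_pdivrMr // (l1norm_nneg w_ge0) !mulr_sumr.
rewrite -{1 2}avg.
split; apply: ler_sum => i _.
  by rewrite mulrC ler_wpM2l ?fmin_le.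
by rewrite [leRHS]mulrC ler_wpM2l ?le_fmax.
Qed.
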